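(* Let $A\in\mathbb{R}^{n,n}$ and $B\in\mathbb{R}^{n,m}$. For $(J,R,Q)\in(\mathbb{R}^{n,n})^3$ let $g(J,R,Q):=B^{\dagger}(A-(J-R)Q)$. Then $$\mathcal K_R(A,B)=\Big\{\, g(J,R,Q)-(I_m-B^{\dagger}B)Y \;\Big|\; (J,R,Q)\in\mathbb{D}\mathbb{H}_{\succ}^n,\ (I_n-BB^{\dagger})(A-(J-R)Q)=0,\ Y\in\mathbb{R}^{m,n}\Big\}.$$
   Context: $\mathbb{R}^{n,m}$ denotes the set of real $n\times m$ matrices. $X^T$ is the transpose and $X^{\dagger}$ the Moore-Penrose pseudoinverse of $X$; $I_n$ is the $n\times n$ identity. $X\succ0$ (resp. $X\succeq 0$) means $X$ is symmetric positive definite (resp. symmetric positive semidefinite). A real square matrix is called stable if all its eigenvalues have real part $\le 0$ and every eigenvalue on the imaginary axis is semisimple. For $A\in\mathbb{R}^{n,n}$ and $B\in\mathbb{R}^{n,m}$, $\mathcal K_R(A,B):=\{K\in\mathbb{R}^{m,n} \mid A-BK \text{ is stable}\}$. The set $\mathbb{D}\mathbb{H}_{\succ}^n:=\{(J,R,Q)\in(\mathbb{R}^{n,n})^3 \mid J^T=-J,\ R\succeq 0,\ Q\succ 0\}$. *)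

(* Defs.v *)
From mathcomp Require Import all_boot all_order all_algebra.
From mathcomp Require Import complex.
From mathcomp Require Import classical_sets reals.

Set Implicit Arguments.
Unset Strict Implicit.
Unset Printing Implicit Defensive.

Import Order.TTheory GRing.Theory Num.Theory.

Local Open Scope classical_set_scope.
Local Open Scope ring_scope.

Section MoorePenrose.
Variable R : realFieldType.

(* The four Penrose equations; over a real field the adjoint is the transpose. *)
Definition penrose (p q : nat) (X : 'M[R]_(p, q)) (Z : 'M[R]_(q, p)) : bool :=
  [&& X *m Z *m X == X,
      Z *m X *m Z == Z,
      (X *m Z)^T == X *m Z &
      (Z *m X)^T == Z *m X].

Lemma penrose_unique (p q : nat) (X : 'M[R]_(p, q)) (Z W : 'M[R]_(q, p)) :
  penrose X Z -> penrose X W -> Z = W.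
Proof.
case/and4P=> /eqP z1 /eqP z2 /eqP z3 /eqP z4.
case/and4P=> /eqP w1 /eqP w2 /eqP w3 /eqP w4.
have XZW : X *m Z = X *m W.
  by rewrite -z3 -[in LHS]w1 -mulmxA trmx_mul z3 w3 mulmxA -mulmxA mulmxA z1.
have ZXW : Z *m X = W *m X.
  by rewrite -z4 -[in LHS]w1 -mulmxA mulmxA trmx_mul w4 z4 -mulmxA (mulmxA X) z1.
by rewrite -z2 ZXW -mulmxA XZW mulmxA w2.
Qed.

Lemma mulmx_tr_eq0 (p q : nat) (X : 'M[R]_(p, q)) : X *m X^T = 0 -> X = 0.
Proof.
move=> X0; apply/matrixP=> i j; rewrite mxE.
have /matrixP/(_ i i) := X0; rewrite !mxE => /eqP.
rewrite psumr_eq0 => [/allP/(_ j)|k _]; last by rewrite mxE -expr2 sqr_ge0.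
by rewrite mem_index_enum mxE mulf_eq0 orbb => /(_ isT)/eqP.
Qed.

Lemma gram_unit (p q : nat) (X : 'M[R]_(p, q)) :
  row_free X -> X *m X^T \in unitmx.
Proof.
move=> fX; rewrite -row_free_unit -kermx_eq0; apply/eqP.
set K := kermx _; have KXX : K *m (X *m X^T) = 0 by exact: mulmx_ker.
apply: (row_free_inj fX); rewrite mul0mx; apply: mulmx_tr_eq0.
by rewrite trmx_mul mulmxA -(mulmxA K) KXX mul0mx.
Qed.

Lemma penrose_exists (p q : nat) (X : 'M[R]_(p, q)) : exists Z, penrose X Z.
Proof.
have [r [C [F [XE fC fF]]]] : exists r (C : 'M_(p, r)) (F : 'M_(r, q)),
    [/\ X = C *m F, row_free C^T & row_free F].
  exists (\rank X), (col_base X), (row_base X).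
  by rewrite mulmx_base row_base_free /row_free mxrank_tr; split=> //;
    exact: col_base_full.
have uF : F *m F^T \in unitmx by exact: gram_unit.
have uC : C^T *m C \in unitmx by rewrite -[X in _ *m X]trmxK gram_unit.
pose Fi := F^T *m invmx (F *m F^T); pose Ci := invmx (C^T *m C) *m C^T.
have FFi : F *m Fi = 1%:M by rewrite mulmxA mulmxV.
have CiC : Ci *m C = 1%:M by rewrite -mulmxA mulVmx.
have XZ : X *m (Fi *m Ci) = C *m Ci.
  by rewrite XE -mulmxA (mulmxA F) FFi mul1mx.
have ZX : Fi *m Ci *m X = Fi *m F.
  by rewrite XE -mulmxA (mulmxA Ci) CiC mul1mx.
exists (Fi *m Ci); apply/and4P; split; apply/eqP.
- by rewrite XZ XE -mulmxA (mulmxA Ci) CiC mul1mx.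
- by rewrite ZX -mulmxA (mulmxA F) FFi mul1mx.
- by rewrite XZ /Ci !trmx_mul trmx_inv trmx_mul !trmxK mulmxA.
- by rewrite ZX /Fi !trmx_mul trmx_inv trmx_mul !trmxK mulmxA.
Qed.

Definition mpinv (p q : nat) (X : 'M[R]_(p, q)) : 'M[R]_(q, p) :=
  xchoose (penrose_exists X).

Lemma mpinvP (p q : nat) (X : 'M[R]_(p, q)) : penrose X (mpinv X).
Proof. exact: xchooseP. Qed.

End MoorePenrose.

Definition posdefmx (R : realFieldType) (n : nat) (X : 'M[R]_n) : Prop :=
  X^T = X /\ forall v : 'cV[R]_n, v != 0 -> 0 < (v^T *m X *m v) 0 0.

Definition possemidefmx (R : realFieldType) (n : nat) (X : 'M[R]_n) : Prop :=
  X^T = X /\ forall v : 'cV[R]_n, 0 <= (v^T *m X *m v) 0 0.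

(* The geometric multiplicity equals the algebraic one. [eigenspace] is the
   left eigenspace, which has the same dimension as the right one. *)
Definition semisimple_eigenvalue (F : fieldType) (n : nat) (X : 'M[F]_n)
    (l : F) : bool :=
  eigenvalue X l && (\rank (eigenspace X l) == mup l (char_poly X)).

(* The eigenvalues of a real matrix are taken in R[i]. *)
Definition stablematrix (R : realType) (n : nat) (X : 'M[R]_n) : Prop :=
  let XC : 'M[R[i]]_n := map_mx (real_complex R) X in
  forall l : R[i], eigenvalue XC l ->
    complex.Re l <= 0 /\
    (complex.Re l = 0 -> semisimple_eigenvalue XC l).

Definition stabilizing_feedbacks (R : realType) (n m : nat)
    (A : 'M[R]_n) (B : 'M[R]_(n, m)) : set 'M[R]_(m, n) :=
  [set K | stablematrix (A - B *m K)].

Definition dh_triples (R : realFieldType) (n : nat) :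
    set ('M[R]_n * 'M[R]_n * 'M[R]_n) :=
  [set t | let: (J, D, Q) := t in
     [/\ J^T = - J, possemidefmx D & posdefmx Q]].
Arguments dh_triples : clear implicits.

Definition dh_feedback (R : realFieldType) (n m : nat) (A : 'M[R]_n)
    (B : 'M[R]_(n, m)) (J D Q : 'M[R]_n) : 'M[R]_(m, n) :=
  mpinv B *m (A - (J - D) *m Q).

(* Main.v *)
(* A feedback K has the stated form iff A - BK = (J - D)Q for some triple, and
   with P = Q^-1 this says that X = A - BK admits a Lyapunov certificate: P is
   positive definite and -(XP + PX^T) is positive semidefinite. It remains to
   see that such a P exists iff X is stable. Over the complex numbers this is an
   induction on the size. An eigenvalue on the imaginary axis is semisimple, so
   it has left and right eigenvectors v and c with vc = 1, and the span of v
   splits off as a direct summand. If no eigenvalue is on the axis, X is block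
   triangular with a diagonal entry l, and diag(t, P') is a strict certificate
   for small t > 0 when P' is one for the other block. The entrywise real part
   of a complex certificate of a real matrix is a real certificate. *)
Require Import Defs.
From mathcomp Require Import all_boot all_order all_algebra complex.
From mathcomp Require Import classical_sets reals boolp.
From mathcomp Require Import ring.

Set Implicit Arguments.
Unset Strict Implicit.
Unset Printing Implicit Defensive.

Import Order.TTheory GRing.Theory Num.Theory.

Local Open Scope classical_set_scope.
Local Open Scope ring_scope.

(** * Invariant subspaces and block triangular form *)

Lemma row_complement (F : fieldType) (r k : nat) (K : 'M[F]_(r, r + k)) :
  row_free K -> exists N : 'M[F]_(k, r + k), col_mx K N \in unitmx.
Proof.
(* Since [K] has full row rank, it is [col_ebase K] times the top [r] rows of the invertible
   [row_ebase K]; the remaining rows complete it to a basis. *)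
move=> fK; exists (dsubmx (row_ebase K)).
have -> : col_mx K (dsubmx (row_ebase K)) =
    block_mx (col_ebase K) 0 0 1%:M *m row_ebase K.
  rewrite -[in RHS](vsubmxK (row_ebase K)) mul_block_col.
  rewrite !mul0mx mul1mx addr0 add0r; congr col_mx.
  rewrite -[in LHS](mulmx_ebase K) (eqP fK) pid_mx_row -mulmxA.
  by rewrite -[row_ebase K in LHS]vsubmxK mul_row_col mul1mx mul0mx addr0.
by rewrite unitmx_mul row_ebase_unit andbT unitmxE det_ublock det1 mulr1
  -unitmxE col_ebase_unit.
Qed.

(** [b] and [X'] are the coordinates of [N *m X] in the basis [col_mx K N]; [X'] represents [X] on
    the quotient by the row span of [K]. *)
Lemma invariant_complement (F : fieldType) (r k : nat) (K : 'M[F]_(r, r + k))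
    (X : 'M[F]_(r + k)) (L : 'M[F]_r) :
  row_free K -> K *m X = L *m K ->
  exists (N : 'M[F]_(k, r + k)) (b : 'M[F]_(k, r)) (X' : 'M[F]_k),
    col_mx K N \in unitmx /\ N *m X = b *m K + X' *m N.
Proof.
move=> /row_complement [N uS] KX.
pose G := N *m X *m invmx (col_mx K N).
exists N, (lsubmx G), (rsubmx G); split=> //.
by rewrite -mul_row_col hsubmxK mulmxKV.
Qed.

(** Similarity invariance in inverse-free form: [S] intertwines the two characteristic matrices over
    the polynomials, and its determinant, a nonzero constant, is cancelled. *)
Lemma char_poly_block_lower (F : fieldType) (r k : nat) (S X : 'M[F]_(r + k))
    (L : 'M[F]_r) (b : 'M[F]_(k, r)) (X' : 'M[F]_k) :
  S \in unitmx -> S *m X = block_mx L 0 b X' *m S ->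
  char_poly X = char_poly L * char_poly X'.
Proof.
move=> uS SX; pose f := map_mx (@polyC F).
have uS' : \det (f _ _ S) != 0.
  by rewrite det_map_mx polyC_eq0 -unitfE -unitmxE.
apply: (mulfI uS'); rewrite /char_poly -det_mulmx.
have -> : f _ _ S *m char_poly_mx X =
    char_poly_mx (block_mx L 0 b X') *m f _ _ S.
  rewrite /char_poly_mx mulmxBr mulmxBl -!map_mxM SX.
  by rewrite scalar_mxC.
rewrite det_mulmx mulrC; congr (_ * _).
rewrite /char_poly_mx map_block_mx map_mx0 (@scalar_mx_block _ r k).
by rewrite opp_block_mx add_block_mx oppr0 addr0 det_lblock.
Qed.

(** * Semisimplicity and Jordan chains *)

Section Jordan.
Variable F : fieldType.

(* No Jordan chain of length two: the kernel and the image of [X - l] meet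
   trivially. *)
Definition chain_free (n : nat) (X : 'M[F]_n) (l : F) :=
  forall u v : 'rV[F]_n, v *m X = l *: v -> u *m X = l *: u + v -> v = 0.

(** In a basis extending one of the eigenspace, [X] is block triangular with diagonal blocks [l%:M]
    of size [r] and [X']. Both sides then say that [l] is not an eigenvalue of [X']: the
    multiplicity of [l] is [r] plus its multiplicity in [char_poly X'], and an eigenvector of [X']
    for [l] yields a Jordan chain. *)
Lemma chain_free_rank_mup (r k : nat) (X : 'M[F]_(r + k)) (l : F) :
  \rank (eigenspace X l) = r ->
  (chain_free X l <-> mup l (char_poly X) = r).
Proof.
move=> rE.
have [K [fK KE]] : exists K : 'M[F]_(r, r + k),
    row_free K /\ (K == eigenspace X l)%MS.
  move: (row_base_free (eigenspace X l)) (eq_row_base (eigenspace X l)).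
  move: (row_base _); rewrite rE => K fK KE; exists K; split=> //.
  exact/eqmxP.
have memK u : (u <= K)%MS = (u *m X == l *: u :> 'rV_(r + k)).
  by rewrite (eqmxP KE); apply/eigenspaceP/eqP.
have KX : K *m X = l%:M *m K.
  by rewrite mul_scalar_mx; apply/eigenspaceP; rewrite (eqmxP KE).
have [N [b [X' [uS NX]]]] := invariant_complement fK KX.
have SX : col_mx K N *m X = block_mx l%:M 0 b X' *m col_mx K N.
  by rewrite mul_block_col mul_col_mx KX NX mul0mx addr0.
have coordE (u : 'rV_(r + k)) : exists p q, u = p *m K + q *m N.
  exists (lsubmx (u *m invmx (col_mx K N))), (rsubmx (u *m invmx (col_mx K N))).
  by rewrite -mul_row_col hsubmxK mulmxKV.
have indep (p : 'rV_r) (q : 'rV_k) :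
    (p *m K + q *m N == 0) = (p == 0) && (q == 0).
  rewrite -mul_row_col mulmx_free_eq0 ?row_free_unit //.
  by rewrite row_mx_eq0.
have XE (p : 'rV_r) (q : 'rV_k) :
    (p *m K + q *m N) *m X = (l *: p + q *m b) *m K + (q *m X') *m N.
  rewrite mulmxDl -!mulmxA KX NX mulmxDr mulmxDl mul_scalar_mx -!scalemxAl.
  by rewrite -scalemxAr -!mulmxA addrA.
have chE : chain_free X l <-> ~~ eigenvalue X' l.
  split=> [cf|neig u v].
    apply/eigenvalueP=> -[q qX q0].
    (* An eigenvector [q] of [X'] makes [q *m N] the top of a chain ending in [q *m b *m K].
       Chain-freeness kills that end, so [q *m N] is itself an eigenvector and lies in the span of
       [K], against independence. *)
    have bK0 : q *m b *m K = 0.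
      apply: (cf (q *m N)).
        by rewrite -mulmxA KX mulmxA mul_mx_scalar -scalemxAl.
      have := XE 0 q; rewrite mul0mx add0r scaler0 add0r qX => ->.
      by rewrite -scalemxAl addrC.
    have : (q *m N <= K)%MS.
      have := XE 0 q; rewrite mul0mx add0r scaler0 add0r qX bK0 add0r.
      by rewrite memK => ->; rewrite -scalemxAl.
    case/submxP=> D qND; have := indep (- D) q.
    by rewrite qND mulNmx addNr eqxx (negbTE q0) andbF.
  (* Conversely, comparing coordinates in the chain equation gives [q *m X' = l *: q], hence
     [q = 0], and then [D = q *m b = 0]. *)
  move/eqP; rewrite -memK => /submxP[D ->].
  have [p [q ->]] := coordE u; rewrite XE mulmxDl -scalemxAl scalerDr -!addrA.
  move=> /addrI E.
  have /eqP : (q *m b - D) *m K + (q *m X' - l *: q) *m N = 0.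
    rewrite !mulmxBl addrACA E -scalemxAl -opprD.
    by rewrite addrC [D *m K + _]addrC addNr.
  rewrite indep.
  case/andP=> /eqP pE /eqP qE.
  have q0 : q = 0.
    apply/eqP; apply: contraNT neig => q0; apply/eigenvalueP; exists q => //.
    by apply/eqP; rewrite -subr_eq0 qE.
  move: pE; rewrite q0 mul0mx sub0r => /eqP.
  by rewrite oppr_eq0 => /eqP ->; rewrite mul0mx.
rewrite chE eigenvalue_root_char (char_poly_block_lower uS SX).
have -> : char_poly (l%:M : 'M_r) = ('X - l%:P) ^+ r.
  rewrite char_poly_trig ?scalar_mx_is_trig //.
  rewrite (eq_bigr (fun=> 'X - l%:P)) ?prodr_const ?card_ord // => i _.
  by rewrite mxE eqxx.
rewrite mupM ?expf_neq0 ?polyXsubC_eq0 ?monic_neq0 ?char_poly_monic //.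
rewrite mup_XsubCX eqxx; split=> [/mupNroot->|]; first by rewrite addn0.
move/eqP; rewrite -[X in _ == X]addn0 eqn_add2l => /eqP m0.
by rewrite -dvdp_XsubCl XsubC_dvd ?m0 ?monic_neq0 ?char_poly_monic.
Qed.

(** The size [n] is rewritten as [r + k], with [r] the dimension of the eigenspace, to fit the block
    form. *)
Lemma semisimpleP (n : nat) (X : 'M[F]_n) (l : F) :
  eigenvalue X l -> (chain_free X l <-> semisimple_eigenvalue X l).
Proof.
move=> eX; rewrite /semisimple_eigenvalue eX /=.
have := rank_leq_row (eigenspace X l).
have [r rE] : {r | \rank (eigenspace X l) = r}.
  by exists (\rank (eigenspace X l)).
rewrite rE => /subnKC nE; move: (n - r)%N nE => k nE.
move: X eX rE; rewrite -nE => X eX rE.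
have -> := chain_free_rank_mup rE.
by split=> [->|/eqP].
Qed.
End Jordan.

Local Open Scope sesquilinear_scope.

(** * Hermitian forms *)

Section HermitianForms.
Variable C : numClosedFieldType.

Lemma adjmxM (m n p : nat) (A : 'M[C]_(m, n)) (B : 'M[C]_(n, p)) :
  (A *m B) ^t* = B ^t* *m A ^t*.
Proof. by rewrite trmx_mul map_mxM. Qed.

Definition hform (n : nat) (H : 'M[C]_n) (u v : 'rV[C]_n) : C :=
  (u *m H *m v ^t*) 0 0.

Definition hpsd (n : nat) (H : 'M[C]_n) : Prop :=
  H ^t* = H /\ forall v : 'rV[C]_n, 0 <= hform H v v.

Definition hpd (n : nat) (H : 'M[C]_n) : Prop :=
  H ^t* = H /\ forall v : 'rV[C]_n, v != 0 -> 0 < hform H v v.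

Lemma hformDl (n : nat) (H : 'M[C]_n) u u' v :
  hform H (u + u') v = hform H u v + hform H u' v.
Proof. by rewrite /hform !mulmxDl mxE. Qed.

Lemma hformDr (n : nat) (H : 'M[C]_n) u v v' :
  hform H u (v + v') = hform H u v + hform H u v'.
Proof. by rewrite /hform linearD map_mxD mulmxDr mxE. Qed.

Lemma hformZl (n : nat) (H : 'M[C]_n) a u v :
  hform H (a *: u) v = a * hform H u v.
Proof. by rewrite /hform -!scalemxAl mxE. Qed.

Lemma hformZr (n : nat) (H : 'M[C]_n) a u v :
  hform H u (a *: v) = a^* * hform H u v.
Proof. by rewrite /hform linearZ map_mxZ -scalemxAr mxE. Qed.

Lemma hform0l (n : nat) (H : 'M[C]_n) v : hform H 0 v = 0.
Proof. by rewrite /hform !mul0mx mxE. Qed.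

Lemma hformC (n : nat) (H : 'M[C]_n) u v :
  H ^t* = H -> hform H v u = (hform H u v)^*.
Proof.
move=> hH; rewrite /hform -[v in LHS]trmxCK -{1}hH -!adjmxM mulmxA.
by rewrite !mxE.
Qed.

Lemma hform_congr (n p : nat) (H : 'M[C]_n) (S : 'M[C]_(p, n)) u v :
  hform (S *m H *m S ^t*) u v = hform H (u *m S) (v *m S).
Proof. by rewrite /hform adjmxM !mulmxA. Qed.

Lemma hform_block (n1 n2 : nat) (A : 'M[C]_n1) (B : 'M[C]_n2) x y x' y' :
  hform (block_mx A 0 0 B) (row_mx x y) (row_mx x' y') =
  hform A x x' + hform B y y'.
Proof.
rewrite /hform mul_row_block !mulmx0 addr0 add0r tr_row_mx map_col_mx.
by rewrite mul_row_col mxE.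
Qed.

Lemma hpdW (n : nat) (H : 'M[C]_n) : hpd H -> hpsd H.
Proof.
case=> hH H0; split=> // v; have [->|v0] := eqVneq v 0.
  by rewrite hform0l.
exact: ltW (H0 _ v0).
Qed.

Lemma hpd_unit (n : nat) (H : 'M[C]_n) : hpd H -> H \in unitmx.
Proof.
case=> _ H0; rewrite -row_free_unit -kermx_eq0; apply/eqP/row_matrixP=> i.
rewrite row0; apply/eqP; apply: contraT => /H0.
by rewrite /hform -row_mul mulmx_ker row0 mul0mx mxE ltxx.
Qed.

Lemma hpd_congr (n : nat) (H S : 'M[C]_n) :
  S \in unitmx -> hpd H -> hpd (S *m H *m S ^t*).
Proof.
move=> uS [hH H0]; split; first by rewrite !adjmxM trmxCK hH mulmxA.
by move=> v v0; rewrite hform_congr H0 // mulmx_free_eq0 ?row_free_unit.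
Qed.

Lemma hform_CauchySchwarz (n : nat) (H : 'M[C]_n) u v :
  hpsd H -> `|hform H u v| ^+ 2 <= hform H u u * hform H v v.
Proof.
case=> hH H0.
set a := hform H u u; set c := hform H v v; set s := hform H u v.
have a0 : 0 <= a by exact: H0.
have c0 : 0 <= c by exact: H0.
have E z : hform H (u + z *: v) (u + z *: v) =
    a + z^* * s + z * s^* + z * z^* * c.
  rewrite hformDl !hformDr !hformZl !hformZr (@hformC _ H u v) // -/s -/a -/c.
  by rewrite !addrA mulrA.
have [c_eq0|c_neq0] := eqVneq c 0; last first.
  have cR : c^* = c by apply/CrealP; exact: ger0_real.
  have zE : (- (s / c))^* = - (s^* / c).
    by rewrite rmorphN rmorphM fmorphV /= cR.
  (* This [z] minimizes the quadratic in [z]. *)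
  have := H0 (u + (- (s / c)) *: v); rewrite E zE.
  have -> : a + - (s^* / c) * s + - (s / c) * s^* +
      - (s / c) * - (s^* / c) * c = a - s * s^* / c by field.
  by rewrite subr_ge0 ler_pdivrMr ?lt_def ?c_neq0 // normCK.
rewrite c_eq0 mulr0; have [->|s0] := eqVneq s 0; first by rewrite normr0 expr0n.
have s2 : s * s^* != 0 by rewrite mulf_neq0 ?conjC_eq0.
have aR : a^* = a by apply/CrealP; exact: ger0_real.
have zE : (- ((a + 1) / s^*))^* = - ((a + 1) / s).
  by rewrite rmorphN rmorphM rmorphD fmorphV /= conjCK rmorph1 aR.
(* With [c = 0] the expression is affine in [z]; this [z] drives it down to [- (a + 2)], which is
   negative. *)
have := H0 (u + (- ((a + 1) / s^*)) *: v); rewrite E zE c_eq0 mulr0 addr0.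
have -> : a + - ((a + 1) / s) * s + - ((a + 1) / s^*) * s^* = - (a + 2).
  by field; rewrite s0 conjC_eq0 s0.
by rewrite oppr_ge0 => /(lt_le_trans (ltr_wpDl a0 (ltr0Sn _ 1))); rewrite ltxx.
Qed.

(* The Lyapunov operator up to sign, so that stability makes it positive. *)
Definition lyap (n : nat) (X P : 'M[C]_n) : 'M[C]_n :=
  - (X *m P + P *m X ^t*).

Lemma lyap_herm (n : nat) (X P : 'M[C]_n) :
  P ^t* = P -> (lyap X P) ^t* = lyap X P.
Proof.
move=> hP; rewrite /lyap linearN map_mxN linearD map_mxD /= !adjmxM hP trmxCK.
by rewrite addrC.
Qed.

Lemma hform_lyap (n : nat) (X P : 'M[C]_n) u v :
  hform (lyap X P) u v = - (hform P (u *m X) v + hform P u (v *m X)).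
Proof.
rewrite /hform /lyap mulmxN mulNmx mxE mulmxDr mulmxDl mxE adjmxM.
by rewrite !mulmxA.
Qed.

(** Carries a certificate across the similarity [S]: the Lyapunov form transforms by congruence. *)
Lemma hform_lyap_congr (n : nat) (X M S P : 'M[C]_n) u v :
  S \in unitmx -> S *m X = M *m S ->
  hform (lyap X (invmx S *m P *m (invmx S) ^t*)) u v =
  hform (lyap M P) (u *m invmx S) (v *m invmx S).
Proof.
move=> uS SX; have XS : X *m invmx S = invmx S *m M.
  by apply: (canRL (mulKmx uS)); rewrite mulmxA SX mulmxK.
by rewrite !hform_lyap !hform_congr -!mulmxA XS.
Qed.

End HermitianForms.

(** * Lyapunov certificates over an algebraically closed field *)

Section Lyapunov.
Variable C : numClosedFieldType.

Lemma hpd_dim0 (H : 'M[C]_0) : hpd H.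
Proof.
by split=> [|v]; [rewrite [RHS]flatmx0 [LHS]flatmx0|rewrite [v]thinmx0 eqxx].
Qed.

Lemma hform_scalar1 (t : C) (x y : 'rV[C]_1) :
  hform t%:M x y = t * (x 0 0 * (y 0 0)^*).
Proof. by rewrite /hform mul_mx_scalar -scalemxAl !mxE big_ord1 !mxE. Qed.

Lemma hpd_scalar1 (t : C) : 0 < t -> hpd (t%:M : 'M_1).
Proof.
move=> t0; split.
  rewrite tr_scalar_mx map_scalar_mx /=; congr _%:M.
  by apply/CrealP; exact: gtr0_real.
move=> x x0; rewrite hform_scalar1 mulr_gt0 // mul_conjC_gt0.
by apply: contraNN x0 => /eqP x00; rewrite [x]mx11_scalar x00 raddf0.
Qed.

Lemma hpd_block (n1 n2 : nat) (A : 'M[C]_n1) (B : 'M[C]_n2) :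
  hpd A -> hpd B -> hpd (block_mx A 0 0 B).
Proof.
move=> pA pB; split.
  by rewrite tr_block_mx map_block_mx !trmx0 !map_mx0 pA.1 pB.1.
move=> w; rewrite -[w]hsubmxK hform_block row_mx_eq0 negb_and.
have hA := (hpdW pA).2; have hB := (hpdW pB).2.
by case/orP => w0; [rewrite ltr_pwDl ?pA.2|rewrite ltr_wpDl ?pB.2].
Qed.

(** The cross term from [b] is written as a [W]-inner product with a fixed vector [c], so
    Cauchy-Schwarz bounds it by the form of [W]; a small weight [t] then lets the diagonal terms
    dominate. *)
Lemma lyap_block_hpd (n : nat) (l : C) (b : 'cV[C]_n) (X P : 'M[C]_n) :
  l + l^* < 0 -> hpd P -> hpd (lyap X P) ->
  exists t : C, 0 < t /\
    hpd (lyap (block_mx l%:M 0 b X : 'M_(1 + n)) (block_mx t%:M 0 0 P)).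
Proof.
move=> l0 pP pW; pose W := lyap X P; pose a := - (l + l^*).
have a0 : 0 < a by rewrite oppr_gt0.
pose c := (invmx W *m b)^t*.
have bE (y : 'rV_n) : (y *m b) 0 0 = hform W y c.
  by rewrite /hform trmxCK -mulmxA mulKVmx // hpd_unit.
pose K := hform W c c; have K0 : 0 <= K by exact: (hpdW pW).2.
have K1 : 0 < K + 1 by rewrite ltr_wpDl.
(* The shift by 1 avoids dividing by zero and makes [t * K < a] strict. *)
pose t := a / (K + 1); have t0 : 0 < t by rewrite divr_gt0.
have tR : t^* = t by apply/CrealP; exact: gtr0_real.
have aR : a^* = a by apply/CrealP; exact: gtr0_real.
have pt := hpd_scalar1 t0.
exists t; split=> //; split; first exact: lyap_herm (hpd_block pt pP).1.
move=> w; rewrite -[w]hsubmxK; set x := lsubmx w; set y := rsubmx w => w0.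
pose z := x 0 0; pose be := hform W y c; pose h := hform W y y.
have h0 : 0 <= h by exact: (hpdW pW).2.
have CS : `|be| ^+ 2 <= h * K by exact: hform_CauchySchwarz (hpdW pW).
have -> : hform (lyap (block_mx l%:M 0 b X : 'M_(1 + n)) (block_mx t%:M 0 0 P))
    (row_mx x y) (row_mx x y) = h - t * (be * z^* + z * be^* - a * (z * z^*)).
  rewrite hform_lyap mul_row_block !mulmx0 add0r !hform_block.
  rewrite /h hform_lyap !hform_scalar1 !mxE -/z.
  have -> : \sum_j y 0 j * b j 0 = be by rewrite /be -bE mxE.
  have wz : w 0 (lshift n 0) = z by rewrite /z mxE.
  rewrite big_ord1 !mxE eqxx mulr1n rmorphD rmorphM /= wz.
  by rewrite /a; ring.
(* The square completed in z leaves a h - t |be|^2, and t K < a. *)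
rewrite -(pmulr_rgt0 _ a0).
have -> : a * (h - t * (be * z^* + z * be^* - a * (z * z^*))) =
    a * h - t * `|be| ^+ 2 + t * `|a * z - be| ^+ 2.
  by rewrite !normCK rmorphB rmorphM /= aR; ring.
(* If [y = 0], positivity comes from the square alone; otherwise the part without the square is
   already strictly positive. *)
have [y0|y0] := eqVneq y 0.
  have -> : be = 0 by rewrite /be y0 hform0l.
  have -> : h = 0 by rewrite /h y0 hform0l.
  rewrite normr0 expr0n !mulr0 !subr0 add0r mulr_gt0 // exprn_gt0 // normr_gt0.
  rewrite mulf_neq0 ?(gt_eqF a0) //; move: w0; rewrite y0 row_mx_eq0 eqxx andbT.
  by apply: contraNN => /eqP z0; rewrite [x]mx11_scalar -/z z0 raddf0.
rewrite ltr_pwDl //; last by rewrite mulr_ge0 ?exprn_ge0 // ltW.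
have hgt0 : 0 < h by exact: pW.2.
rewrite subr_gt0 (le_lt_trans (ler_wpM2l (ltW t0) CS)) //.
rewrite mulrCA [a * h]mulrC ltr_pM2l // /t mulrAC ltr_pdivrMr // ltr_pM2l //.
by rewrite ltrDl.
Qed.

(** Induction by splitting off a left eigenvector. The hypothesis passes to the quotient block
    because [char_poly X'] divides [char_poly X]. *)
Lemma lyapunov_strict (n : nat) (X : 'M[C]_n) :
  (forall l, eigenvalue X l -> l + l^* < 0) ->
  exists P, hpd P /\ hpd (lyap X P).
Proof.
elim: n X => [|n IHn] X Xneg; first by exists 0; split; exact: hpd_dim0.
have [l el] := eigenvalue_closed X (ltn0Sn n).
have [v vX v0] := eigenvalueP el.
have fv : row_free v by rewrite /row_free rank_rV v0.
have [|N [b [X' [uS NX]]]] := @invariant_complement _ 1 n v X l%:M fv.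
  by rewrite mul_scalar_mx.
have SX : col_mx v N *m X = block_mx l%:M 0 b X' *m col_mx v N.
  by rewrite mul_block_col mul_col_mx vX NX mul0mx addr0 mul_scalar_mx.
have [|P [pP pW]] := IHn X'.
  move=> k; rewrite eigenvalue_root_char => ek; apply: Xneg.
  by rewrite eigenvalue_root_char (char_poly_block_lower uS SX) rootM ek orbT.
have [t [t0 pWt]] := lyap_block_hpd b (Xneg _ el) pP pW.
pose S := col_mx v N; have uS' : invmx S \in unitmx by rewrite unitmx_inv.
have pP' := hpd_block (hpd_scalar1 t0) pP.
exists (invmx S *m block_mx t%:M 0 0 P *m (invmx S)^t*).
split; first exact: hpd_congr.
split; first by apply: lyap_herm; exact: (hpd_congr uS' pP').1.
move=> w w0; rewrite (hform_lyap_congr _ _ _ uS SX); apply: pWt.2.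
by rewrite mulmx_free_eq0 ?row_free_unit.
Qed.

(** [l + l^*] is twice the real part, in the shape produced by the Lyapunov form. [chain_free]
    replaces the multiplicity condition because it passes directly to invariant subspaces. *)
Definition marginally_stable (n : nat) (X : 'M[C]_n) : Prop :=
  forall l, eigenvalue X l -> l + l^* <= 0 /\ (l + l^* = 0 -> chain_free X l).

(** The columns of the cokernel of [X - l%:M] are right eigenvectors. They cannot all annihilate
    [v], since then [v] would lie in the row space of [X - l%:M] and end a Jordan chain. *)
Lemma dual_eigenvector (n : nat) (X : 'M[C]_n) (l : C) (v : 'rV[C]_n) :
  chain_free X l -> v *m X = l *: v -> v != 0 ->
  exists c : 'cV[C]_n, X *m c = l *: c /\ v *m c = 1%:M.
Proof.
move=> cf vX v0.
have : ~~ (v <= X - l%:M)%MS.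
  apply: contraNN v0 => /submxP[u uE]; apply/eqP; apply: (cf u) => //.
  by rewrite uE mulmxBr mul_mx_scalar addrC subrK.
rewrite submxE => /rV0Pn[j]; set a := (_ *m _) _ _ => a0.
exists (a^-1 *: col j (cokermx (X - l%:M))); split.
  apply/eqP; rewrite -subr_eq0 -scalemxAr -mul_scalar_mx -[l *: _]mul_scalar_mx.
  rewrite -scalemxAr mul_scalar_mx -scalerBr -mulmxBl colE mulmxA mulmx_coker.
  by rewrite mul0mx scaler0.
rewrite -scalemxAr colE mulmxA [v *m _ *m _]mx11_scalar -colE mxE -/a.
by rewrite scale_scalar_mx mulVf.
Qed.

(** Axis eigenvalues are removed one at a time; once none is left, the strict certificate
    applies. *)
Lemma lyapunov_weak (n : nat) (X : 'M[C]_n) :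
  marginally_stable X -> exists P, hpd P /\ hpsd (lyap X P).
Proof.
elim: n X => [|n IHn] X Xst.
  by exists 0; split; [|apply: hpdW]; exact: hpd_dim0.
have [[l [el l0]]|noaxis] := EM (exists l, eigenvalue X l /\ l + l^* = 0);
    last first.
  have [|P [pP pW]] := @lyapunov_strict _ X.
    move=> l el; rewrite lt_def (Xst l el).1 andbT eq_sym.
    by apply/negP=> /eqP l0; apply: noaxis; exists l.
  by exists P; split=> //; exact: hpdW.
have [v vX v0] := eigenvalueP el.
have [c [cX vc]] := dual_eigenvector ((Xst l el).2 l0) vX v0.
have fv : row_free v by rewrite /row_free rank_rV v0.
have [|N0 [b [X' [uS0 NX0]]]] := @invariant_complement _ 1 n v X l%:M fv.
  by rewrite mul_scalar_mx.
(* Projecting along v onto the kernel of c makes the complement invariant. *)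
pose N := N0 - N0 *m c *m v.
have Nc : N *m c = 0 by rewrite mulmxBl -(mulmxA _ v) vc mulmx1 subrr.
have uS : col_mx v N \in unitmx.
  have -> : col_mx v N = block_mx 1%:M 0 (- (N0 *m c)) 1%:M *m col_mx v N0.
    by rewrite mul_block_col !mul1mx mul0mx addr0 mulNmx addrC.
  by rewrite unitmx_mul uS0 unitmxE det_lblock !det1 mulr1 unitr1.
have NX : N *m X = X' *m N.
  have [b' NXb] : exists b', N *m X = b' *m v + X' *m N.
    exists (b - l *: (N0 *m c) + X' *m (N0 *m c)).
    rewrite mulmxBl NX0 -!mulmxA vX mulmxBr mulmxDl mulmxBl.
    rewrite -!scalemxAr -scalemxAl.
    rewrite !mulmxA -!addrA; congr (_ + _).
    by rewrite [RHS]addrC [X in _ = X - _]addrC subrK.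
  (* Multiplying by [c] on the right isolates [b'], while [N *m X *m c = l *: (N *m c) = 0]. *)
  rewrite NXb; suff -> : b' = 0 by rewrite mul0mx add0r.
  have : N *m X *m c = b'.
    by rewrite NXb mulmxDl -!mulmxA vc mulmx1 Nc mulmx0 addr0.
  by rewrite -mulmxA cX -scalemxAr Nc scaler0.
have SX : col_mx v N *m X = block_mx l%:M 0 0 X' *m col_mx v N.
  by rewrite mul_block_col mul_col_mx vX NX !mul0mx addr0 add0r mul_scalar_mx.
have fN : row_free N.
  rewrite -kermx_eq0; apply/eqP/row_matrixP=> i; rewrite row0.
  have : row i (kermx N) *m N = 0 by rewrite -row_mul mulmx_ker row0.
  set q := row _ _ => qN; have : row_mx 0 q *m col_mx v N = 0.
    by rewrite mul_row_col mul0mx add0r.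
  move=> /eqP; rewrite mulmx_free_eq0 ?row_free_unit // row_mx_eq0.
  by case/andP=> _ /eqP.
have [|P [pP pW]] := IHn X'.
  (* Eigenvectors and chains of [X'] lift to [X] along the injective map sending [q] to [q *m N],
     which intertwines the two matrices. *)
  move=> k /eigenvalueP[q qX q0].
  have [|k0 cf] := Xst k.
    apply/eigenvalueP; exists (q *m N); last by rewrite mulmx_free_eq0.
    by rewrite -mulmxA NX mulmxA qX scalemxAl.
  split=> // k00 u w wX uX.
  apply/eqP; rewrite -(mulmx_free_eq0 w fN); apply/eqP.
  apply: (cf k00 (u *m N)); first by rewrite -mulmxA NX mulmxA wX scalemxAl.
  by rewrite -mulmxA NX mulmxA uX mulmxDl scalemxAl.
pose S := col_mx v N; have uS' : invmx S \in unitmx by rewrite unitmx_inv.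
have pP' := hpd_block (hpd_scalar1 ltr01) pP.
exists (invmx S *m block_mx 1%:M 0 0 P *m (invmx S)^t*).
split; first exact: hpd_congr.
split; first by apply: lyap_herm; exact: (hpd_congr uS' pP').1.
move=> w; rewrite (hform_lyap_congr _ _ _ uS SX).
rewrite -[w *m _]hsubmxK; set x := lsubmx _; set y := rsubmx _.
rewrite hform_lyap mul_row_block !mulmx0 addr0 add0r !hform_block.
(* The [v] coordinate contributes a multiple of [l + l^*], that is, nothing. *)
rewrite mul_mx_scalar hformZl hformZr addrACA -mulrDl l0 mul0r add0r.
by have := pW.2 y; rewrite hform_lyap.
Qed.

(** On an eigenvector [v] the Lyapunov form is [hform P v v] times minus [l + l^*], which gives the
    sign. On the axis [v] is therefore isotropic, hence orthogonal to every [u] by Cauchy-Schwarz;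
    but the top [u] of a chain pairs with [v] to [- hform P v v]. *)
Lemma lyapunov_converse (n : nat) (X P : 'M[C]_n) :
  hpd P -> hpsd (lyap X P) -> marginally_stable X.
Proof.
move=> pP pW l /eigenvalueP[w wX w0].
have WE v : v *m X = l *: v ->
    hform (lyap X P) v v = - ((l + l^*) * hform P v v).
  by move=> vX; rewrite hform_lyap vX hformZl hformZr mulrDl.
split.
  by have := pW.2 w; rewrite WE // oppr_ge0 pmulr_lle0 // pP.2.
move=> l0 u v vX uX; have := hform_CauchySchwarz u v pW.
rewrite (WE v) // l0 mul0r oppr0 mulr0 => s0.
have : hform (lyap X P) u v == 0.
  by rewrite -normr_eq0 -sqrf_eq0 eq_le s0 exprn_ge0.
rewrite hform_lyap uX vX hformDl hformZl hformZr addrAC -mulrDl l0 mul0r add0r.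
rewrite oppr_eq0; apply: contraTeq => v0.
by rewrite gt_eqF // pP.2.
Qed.

End Lyapunov.

(** * Real matrices *)

Section RealLyapunov.
Variable R : realType.

Local Notation RC := (real_complex R).
Local Notation rmx H := (map_mx (@complex.Re R) H).
Local Notation cmx H := (map_mx RC H).

Lemma map_Re_mull (m n p : nat) (A : 'M[R]_(m, n)) (M : 'M[R[i]]_(n, p)) :
  rmx (cmx A *m M) = A *m rmx M.
Proof.
apply/matrixP=> i j; rewrite !mxE raddf_sum; apply: eq_bigr => k _.
by rewrite !mxE /=; case: (M k j) => a b /=; rewrite mul0r subr0.
Qed.

Lemma map_Re_mulr (m n p : nat) (A : 'M[R]_(n, p)) (M : 'M[R[i]]_(m, n)) :
  rmx (M *m cmx A) = rmx M *m A.
Proof.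
apply/matrixP=> i j; rewrite !mxE raddf_sum; apply: eq_bigr => k _.
by rewrite !mxE /=; case: (M i k) => a b /=; rewrite mulr0 subr0.
Qed.

Lemma conj_real (x : R) : (RC x)^* = RC x.
Proof. by apply/CrealP; rewrite realE !lecE /= eqxx /= ; exact: num_real. Qed.

Lemma adj_complex (m n : nat) (A : 'M[R]_(m, n)) : (cmx A) ^t* = cmx A^T.
Proof. by apply/matrixP=> i j; rewrite !mxE /= conj_real. Qed.

Lemma Re_conj (z : R[i]) : complex.Re z^* = complex.Re z.
Proof. by case: z. Qed.

Lemma map_Re_adj (m n : nat) (A : 'M[R[i]]_(m, n)) : rmx (A ^t*) = (rmx A)^T.
Proof. by apply/matrixP=> i j; rewrite !mxE Re_conj. Qed.

Lemma real_complex_le0 (x : R) : (RC x <= 0) = (x <= 0).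
Proof. by rewrite lecE /= eqxx. Qed.

Lemma stablematrixP (n : nat) (X : 'M[R]_n) :
  stablematrix X <-> marginally_stable (cmx X).
Proof.
have sumJ (l : R[i]) : l + l^* = 2 * RC (complex.Re l) := addcJ l.
have axis (l : R[i]) : l + l^* = 0 <-> complex.Re l = 0.
  rewrite sumJ; split=> [/eqP|->]; last by rewrite mulr0.
  by rewrite mulf_eq0 pnatr_eq0 /= => /eqP/(congr1 (@complex.Re R)).
have neg (l : R[i]) : (l + l^* <= 0) = (complex.Re l <= 0).
  by rewrite sumJ pmulr_rle0 // real_complex_le0.
split=> [Xst l el|Xst XC l el]; have [l0 lss] := Xst l el; split.
- by rewrite neg.
- by move=> /axis/lss/(semisimpleP el).
- by rewrite -neg.
- by move=> /axis/lss/(semisimpleP el).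
Qed.

Lemma hform_complex (n : nat) (H : 'M[R]_n) (a b : 'rV[R]_n) :
  hform (cmx H) (cmx a) (cmx b) = RC ((a *m H *m b^T) 0 0).
Proof. by rewrite /hform adj_complex -!map_mxM mxE. Qed.

Lemma row_ReIm (n : nat) (w : 'rV[R[i]]_n) :
  exists a b : 'rV[R]_n, w = cmx a + 'i *: cmx b.
Proof.
exists (rmx w), (map_mx (@complex.Im R) w); apply/matrixP=> i j; rewrite !mxE.
by rewrite {1}[w i j]complexE.
Qed.

(** The two cross terms carry the factors ['i] and [- 'i] and cancel by symmetry of [H]. *)
Lemma hform_ReIm (n : nat) (H : 'M[R]_n) (a b : 'rV[R]_n) : H^T = H ->
  hform (cmx H) (cmx a + 'i *: cmx b) (cmx a + 'i *: cmx b) =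
  RC ((a *m H *m a^T) 0 0 + (b *m H *m b^T) 0 0).
Proof.
move=> hH; rewrite hformDl !hformDr !hformZl !hformZr conjCi !hform_complex.
have -> : (b *m H *m a^T) 0 0 = (a *m H *m b^T) 0 0.
  by rewrite -[in LHS]hH -[b in LHS]trmxK -!trmx_mul mulmxA mxE.
rewrite mulrA mulrN -expr2 sqrCi opprK mul1r addrA -[X in X + _]addrA.
by rewrite mulNr addNr addr0 rmorphD.
Qed.

Lemma posdef_complex (n : nat) (H : 'M[R]_n) : posdefmx H -> hpd (cmx H).
Proof.
case=> hH H0; split; first by rewrite adj_complex hH.
have H0' (a : 'rV_n) : a != 0 -> 0 < (a *m H *m a^T) 0 0.
  by move=> a0; have := H0 a^T; rewrite trmxK trmx_eq0; apply.
have H1 (a : 'rV_n) : 0 <= (a *m H *m a^T) 0 0.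
  by have [->|/H0'/ltW//] := eqVneq a 0; rewrite !mul0mx mxE.
move=> w; have [a [b ->]] := row_ReIm w; rewrite hform_ReIm // ltcE /= eqxx /=.
have [->|/H0' a0] := eqVneq a 0; last by rewrite ltr_pwDl.
have [->|/H0' b0] := eqVneq b 0; last by rewrite ltr_wpDl.
by rewrite !map_mx0 scaler0 addr0 eqxx.
Qed.

Lemma possemidef_complex (n : nat) (H : 'M[R]_n) :
  possemidefmx H -> hpsd (cmx H).
Proof.
case=> hH H0; split; first by rewrite adj_complex hH.
move=> w; have [a [b ->]] := row_ReIm w; rewrite hform_ReIm // lecE /= eqxx /=.
by have := H0 a^T; have := H0 b^T; rewrite !trmxK => b0 a0; rewrite addr_ge0.
Qed.

Lemma Re_hform (n : nat) (H : 'M[R[i]]_n) (a : 'rV[R]_n) :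
  (a *m rmx H *m a^T) 0 0 = complex.Re (hform H (cmx a) (cmx a)).
Proof. by rewrite /hform adj_complex -map_Re_mull -map_Re_mulr mxE. Qed.

Lemma hpd_Re (n : nat) (H : 'M[R[i]]_n) : hpd H -> posdefmx (rmx H).
Proof.
case=> hH H0; split=> [|v v0]; first by rewrite -map_Re_adj hH.
have := H0 (cmx v^T); rewrite map_mx_eq0 trmx_eq0 => /(_ v0).
by have := Re_hform H v^T; rewrite trmxK => ->; rewrite ltcE => /andP[].
Qed.

Lemma hpsd_Re (n : nat) (H : 'M[R[i]]_n) : hpsd H -> possemidefmx (rmx H).
Proof.
case=> hH H0; split=> [|v]; first by rewrite -map_Re_adj hH.
have := H0 (cmx v^T).
by have := Re_hform H v^T; rewrite trmxK => ->; rewrite lecE => /andP[].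
Qed.

(** Entrywise real parts commute with multiplication by real matrices, so the real part of a complex
    certificate certifies [X]. *)
Lemma stablematrix_lyapunov (n : nat) (X : 'M[R]_n) :
  stablematrix X <->
  exists P, posdefmx P /\ possemidefmx (- (X *m P + P *m X^T)).
Proof.
rewrite stablematrixP; split=> [/lyapunov_weak[P [pP pW]]|[P [pP pW]]].
  exists (rmx P); split; first exact: hpd_Re.
  have := hpsd_Re pW; rewrite /lyap adj_complex map_mxN map_mxD.
  by rewrite map_Re_mull map_Re_mulr.
apply: (lyapunov_converse (posdef_complex pP)).
have := possemidef_complex pW.
by rewrite /lyap adj_complex map_mxN map_mxD !map_mxM.
Qed.

Lemma posdef_unit (n : nat) (P : 'M[R]_n) : posdefmx P -> P \in unitmx.
Proof. by move=> /posdef_complex/hpd_unit; rewrite map_unitmx. Qed.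

Lemma posdef_inv (n : nat) (P : 'M[R]_n) : posdefmx P -> posdefmx (invmx P).
Proof.
move=> pP; have uP := posdef_unit pP; have [hP P0] := pP.
have hPi : (invmx P)^T = invmx P by rewrite trmx_inv hP.
split=> // v v0; have := P0 (invmx P *m v).
rewrite trmx_mul hPi -!mulmxA mulKVmx // mulmxA; apply.
by apply: contraNN v0 => /eqP Pv; rewrite -[v](mulKVmx uP) Pv mulmx0.
Qed.

Lemma stablematrix_dh (n : nat) (X : 'M[R]_n) :
  stablematrix X <->
  exists J D Q, dh_triples R n (J, D, Q) /\ X = (J - D) *m Q.
Proof.
rewrite stablematrix_lyapunov.
split=> [[P [pP pW]]|[J [D [Q [[hJ pD pQ] ->]]]]].
  have hP := pP.1.
  (* [J] and [- D] are the skew and symmetric parts of [X *m P], so that [X *m P = J - D]. *)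
  exists (2^-1 *: (X *m P - P *m X^T)), (2^-1 *: - (X *m P + P *m X^T)).
  exists (invmx P).
  split; last first.
    rewrite -scalerBr opprK addrACA addNr addr0 -mulr2n -scaler_nat scalerA.
    by rewrite mulVf ?pnatr_eq0 // scale1r mulmxK // posdef_unit.
  split; last exact: posdef_inv.
    by rewrite linearZ linearB /= !trmx_mul hP trmxK -scalerN opprB.
  split; first by rewrite linearZ /= pW.1.
  move=> v; rewrite -scalemxAr -scalemxAl mxE mulr_ge0 ?invr_ge0 ?ler0n //.
  exact: pW.2.
(* With [P = invmx Q], the product [X *m P] is [J - D] and the Lyapunov expression collapses to
   [D *+ 2]. *)
exists (invmx Q); split; first exact: posdef_inv.
have uQ := posdef_unit pQ.
rewrite mulmxK // trmx_mul pQ.1 mulKmx // linearB /= hJ pD.1.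
have -> : - (J - D + (- J - D)) = D *+ 2.
  by rewrite addrACA subrr add0r -opprD opprK mulr2n.
split; first by rewrite linearMn /= pD.1.
by move=> v; rewrite mulmxDr mulmxDl mxE addr_ge0 // pD.2.
Qed.

End RealLyapunov.

(** * Parametrization of the stabilizing feedbacks *)

Theorem theorem2 (R : realType) (n m : nat)
    (A : 'M[R]_n) (B : 'M[R]_(n, m)) :
  stabilizing_feedbacks A B =
  [set K : 'M[R]_(m, n) |
    exists (J D Q : 'M[R]_n) (Y : 'M[R]_(m, n)),
      [/\ dh_triples R n (J, D, Q),
          (1%:M - B *m mpinv B) *m (A - (J - D) *m Q) = 0 &
          K = dh_feedback A B J D Q - (1%:M - mpinv B *m B) *m Y]].
Proof.
have BPB : B *m mpinv B *m B = B by case/and4P: (mpinvP B) => /eqP.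
apply/seteqP; split=> K /=.
  (* Here [dh_feedback] equals [mpinv B *m B *m K], and [Y = - K] restores the missing component of
     [K]. *)
  move=> /stablematrix_dh[J [D [Q [dh XE]]]]; exists J, D, Q, (- K).
  have BK : A - (J - D) *m Q = B *m K by rewrite -XE opprB addrC subrK.
  split=> //; rewrite ?/dh_feedback BK.
    by rewrite mulmxA mulmxBl mul1mx BPB subrr mul0mx.
  by rewrite mulmxN opprK mulmxBl mul1mx mulmxA addrC subrK.
move=> [J [D [Q [Y [dh E0 ->]]]]]; apply/stablematrix_dh; exists J, D, Q.
split=> //; move/eqP: E0; rewrite mulmxBl mul1mx subr_eq0 => /eqP E.
(* The [Y] term is invisible to [B], so the closed loop is [(J - D) *m Q] whatever [Y] is. *)
have BZ : B *m (1%:M - mpinv B *m B) = 0.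
  by rewrite mulmxBr mulmx1 mulmxA BPB subrr.
rewrite mulmxBr (mulmxA B (1%:M - _)) BZ mul0mx subr0.
by rewrite /dh_feedback mulmxA -E opprB addrC subrK.
Qed.
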